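(* Let $m\ge 1$, let $\{u_i\}_{i=1}^m$ and $\{v_i\}_{i=1}^m$ be orthonormal sets of functions in $H^2$, and let $\mathcal{M}$ be a closed subspace of $H^2$. If $\mathcal{M}$ is invariant under \[ T_z^* - \sum_{i=1}^{m} v_i \otimes u_i, \] then $\mathcal{M}$ is almost invariant under $T_z^*$ with defect at most $m$. Conversely, if $\mathcal{M}$ is almost invariant under $T_z^*$ with defect $m$, then $\mathcal{M}$ is invariant under the rank-$t$ perturbation \[ T_z^* - \sum_{i=1}^{m} f_i \otimes T_z f_i, \] where $\{f_i:1\leq i\leq m\}$ is an orthonormal basis of the $m$-dimensional defect space and $t \leq m$.
   Context: $H^2$ is the Hardy space on the open unit disc $\mathbb{D}$, $T_zf=zf$ on $H^2$, and $T_z^*$ is its adjoint (backward shift). For $u,v\in H^2$, $(u\otimes v)f=\langle f,v\rangle u$. A closed subspace $\mathcal{M}$ of a Hilbert space $\mathcal{H}$ is almost invariant for (under) a bounded operator $T$ on $\mathcal{H}$ if there is a finite-dimensional subspace $\mathcal{F}\subseteq\mathcal{H}$ with $T\mathcal{M}\subseteq\mathcal{M}\oplus\mathcal{F}$, where $\oplus$ is the orthogonal direct sum (so $\mathcal{F}\perp\mathcal{M}$). The defect of $\mathcal{M}$ is the lowest possible dimension of such an $\mathcal{F}$, and a defect space is such an $\mathcal{F}$ of lowest dimension. ''Rank-$t$ perturbation'' means that the operator $\sum_{i=1}^m f_i\otimes T_zf_i$ has $t$-dimensional range. *)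

(* Defs.v *)
From HB Require Import structures.
From mathcomp Require Import all_boot all_order all_algebra sesquilinear.
From mathcomp Require Import complex ring lra.
From mathcomp Require Import all_classical all_reals all_analysis.
Set Implicit Arguments.
Unset Strict Implicit.
Unset Printing Implicit Defensive.
Import Order.TTheory GRing.Theory Num.Theory.
Import numFieldNormedType.Exports.
Local Open Scope ring_scope.
Local Open Scope classical_set_scope.

(* the usual topology of the complex plane, R[i] normed over itself *)
HB.instance Definition _ (R : realType) := NormedModule.copy R[i] R[i]^o.

Section ComplexSeries.
Variable R : realType.
Local Notation C := R[i].
Implicit Types (a b u v : nat -> C) (z l m : C).

Lemma cvgc_ex u : cvgn u <-> exists l : C, u @ \oo --> l.
Proof. by split=> [/cvg_ex|] [l ul]; [exists l|apply/cvg_ex; exists l]. Qed.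

Lemma eq_cvgc u v (l : C) : u =1 v -> u @ \oo --> l -> v @ \oo --> l.
Proof. by move=> /funext ->. Qed.

Lemma eq_cvg_series a b (l : C) :
  a =1 b -> series a @ \oo --> l -> series b @ \oo --> l.
Proof. by move=> /funext ->. Qed.

Lemma cvgc_unique u (l m : C) : u @ \oo --> l -> u @ \oo --> m -> l = m.
Proof. by move=> ul um; exact: (cvg_unique (@norm_hausdorff _ C) ul um). Qed.

Lemma cvgc_cst (c : C) : (fun _ : nat => c) @ \oo --> c.
Proof. exact: cvg_cst. Qed.

Lemma cvgcS u (l : C) :
  u @ \oo --> l <-> (fun n => u n.+1) @ \oo --> l.
Proof. by rewrite (cvg_shiftS u). Qed.

Lemma cvgcD u v (l m : C) :
  u @ \oo --> l -> v @ \oo --> m -> (fun n => u n + v n) @ \oo --> l + m.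
Proof. by move=> ul vm; exact: (cvgD ul vm). Qed.

Lemma cvgcB u v (l m : C) :
  u @ \oo --> l -> v @ \oo --> m -> (fun n => u n - v n) @ \oo --> l - m.
Proof. by move=> ul vm; exact: (cvgB ul vm). Qed.

Lemma cvgcMl (k : C) u (l : C) :
  u @ \oo --> l -> (fun n => k * u n) @ \oo --> k * l.
Proof. by move=> ul; exact: (cvgM (cvg_cst k) ul). Qed.

Lemma normc_real (x : R) : `|x%:C%C : C| = (`|x|)%:C%C.
Proof. by rewrite normc_def /= expr0n /= addr0 sqrtr_sqr. Qed.

Lemma cvg_real_complex (r : nat -> R) (x : R) :
  r @ \oo --> x -> (fun n => (r n)%:C%C : C) @ \oo --> (x%:C%C : C).
Proof.
move=> rx; apply/cvgrPdist_lt => e e0.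
have e0' : 0 < complex.Re e by move: e0; rewrite ltcE => /andP[].
near=> n.
have Ie : complex.Im e = 0 by move: e0; rewrite ltcE => /andP[/eqP ->].
rewrite -rmorphB normc_real ltcE /= Ie eqxx /=.
near: n; by move/cvgrPdist_lt : rx; apply.
Unshelve. all: by end_near. Qed.

Lemma normc_ReIm z :
  `|z| <= (`|complex.Re z| + `|complex.Im z|)%:C%C.
Proof.
rewrite {1}[z]complexE (le_trans (ler_normD _ _)) // normrM normc_real.
rewrite rmorphD lerD2l (_ : `|'i%C| = 1) ?mul1r ?normc_real //.
by rewrite normc_def /= expr0n /= add0r expr1n sqrtr1.
Qed.

Lemma normc_ge_Im z : (`|complex.Im z|)%:C%C <= `|z|.
Proof.
by rewrite normc_def lecR -sqrtr_sqr ler_wsqrtr // lerDr sqr_ge0.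
Qed.

Lemma cvg_complexP u l :
  u @ \oo --> l <->
  ((fun n => complex.Re (u n)) @ \oo --> complex.Re l) /\
  ((fun n => complex.Im (u n)) @ \oo --> complex.Im l).
Proof.
split=> [/cvgrPdist_lt ul|[/cvgrPdist_lt rl /cvgrPdist_lt il]].
  split; apply/cvgrPdist_lt => e e0.
    near=> n; rewrite -raddfB -ltcR; apply: le_lt_trans (normc_ge_Re _) _.
    by near: n; apply: ul; rewrite ltcR.
  near=> n; rewrite -raddfB -ltcR; apply: le_lt_trans (normc_ge_Im _) _.
  by near: n; apply: ul; rewrite ltcR.
apply/cvgrPdist_lt => e e0.
have e0' : 0 < complex.Re e by move: e0; rewrite ltcE => /andP[].
have eE : e = (complex.Re e)%:C%C.
  by case: (e) e0 => x y; rewrite ltcE => /andP[/eqP /= ->].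
near=> n; apply: le_lt_trans (normc_ReIm _) _.
rewrite eE ltcR (splitr (complex.Re e)) ltrD // raddfB.
  by near: n; apply: rl; rewrite divr_gt0.
by near: n; apply: il; rewrite divr_gt0.
Unshelve. all: by end_near. Qed.

Lemma Re_series a n :
  complex.Re (series a n) = series (fun k => complex.Re (a k)) n.
Proof. by rewrite /series /= raddf_sum. Qed.

Lemma Im_series a n :
  complex.Im (series a n) = series (fun k => complex.Im (a k)) n.
Proof. by rewrite /series /= raddf_sum. Qed.

Lemma is_cvg_complex u :
  cvgn (fun n => complex.Re (u n)) -> cvgn (fun n => complex.Im (u n)) ->
  cvgn u.
Proof.
move=> /cvg_ex[x xP] /cvg_ex[y yP]; apply/cvg_ex; exists (x +i* y)%C.
by apply/cvg_complexP.
Qed.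

Lemma series_dom_cvg a b :
  (forall n, `|a n| <= b n) -> cvgn (series b) -> cvgn (series a).
Proof.
move=> ab /cvg_ex[l /cvg_complexP[bl _]].
have cb : cvgn (series (fun k => complex.Re (b k))).
  by apply/cvg_ex; exists (complex.Re l); under eq_cvg do rewrite -Re_series.
have b0 n : 0 <= complex.Re (b n).
  by have := le_trans (normr_ge0 _) (ab n); rewrite lecE => /andP[].
have Reab n : complex.Re `|a n| <= complex.Re (b n).
  by have := ab n; rewrite lecE => /andP[].
have H (F : C -> R) : (forall z, (`|F z|)%:C%C <= `|z|) ->
    cvgn (series (fun k => F (a k))).
  move=> FP; apply: normed_cvg; apply: series_le_cvg cb => //= n.
  apply: le_trans (Reab n).
  by have := FP (a n); rewrite lecE => /andP[].
apply: is_cvg_complex.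
  under eq_is_cvg do rewrite Re_series; exact: H (@normc_ge_Re _).
under eq_is_cvg do rewrite Im_series; exact: H normc_ge_Im.
Qed.

Lemma cvg_conjc u l :
  u @ \oo --> l -> (fun n => (u n)^*) @ \oo --> l^*.
Proof.
move=> /cvg_complexP[h1 h2]; apply/cvg_complexP; split.
  have E (z : C) : complex.Re z^* = complex.Re z by case: z.
  by rewrite E; under eq_cvg do rewrite E.
have E (z : C) : complex.Im z^* = - complex.Im z by case: z.
by rewrite E; under eq_cvg do rewrite E; exact: cvgN.
Qed.

Lemma cvgc_ge c u l :
  (\forall n \near \oo, c <= u n) -> u @ \oo --> l -> c <= l.
Proof.
move=> cu /cvg_complexP[h1 h2]; rewrite lecE; apply/andP; split.
  apply/eqP/esym.
  have h3 : (fun n => complex.Im (u n)) @ \oo --> complex.Im c.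
    apply: cvg_near_cst; near=> n.
    have : c <= u n by near: n.
    by rewrite lecE => /andP[/eqP].
  exact: (cvg_unique _ h3 h2).
have -> : complex.Re l = limn (fun n => complex.Re (u n)).
  by apply/esym/cvg_lim.
apply: limr_ge; first by apply/cvg_ex; exists (complex.Re l).
near=> n.
have : c <= u n by near: n.
by rewrite lecE => /andP[].
Unshelve. all: by end_near. Qed.

Lemma cvgc_le c u l :
  (\forall n \near \oo, u n <= c) -> u @ \oo --> l -> l <= c.
Proof.
move=> cu ul; rewrite -lerN2; apply: (@cvgc_ge _ (fun n => - u n)); last exact: cvgN.
by near=> n; rewrite lerN2; near: n.
Unshelve. all: by end_near. Qed.

End ComplexSeries.

Arguments cvgcMl {R} k {u l}.
Arguments cvgc_cst {R} c.

Section SquareSummable.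
Variable R : realType.
Local Notation C := R[i].
Implicit Types (a b : nat -> C).

Definition square_summable a := cvgn (series (fun n => `|a n| ^+ 2)).

Lemma square_summable0 : square_summable (fun=> 0).
Proof.
rewrite /square_summable; under eq_fun do rewrite normr0 expr0n /=.
apply: is_cvg_near_cst; apply: nearW => n.
by rewrite /series /= big1.
Qed.

Lemma ler_sqrD2 (x y : C) : 0 <= x -> 0 <= y ->
  (x + y) ^+ 2 <= 2 * x ^+ 2 + 2 * y ^+ 2.
Proof.
move=> x0 y0; rewrite -subr_ge0 (_ : _ - _ = (x - y) ^+ 2); last by ring.
by rewrite real_exprn_even_ge0 // rpredB ?ger0_real.
Qed.

Lemma ler_mul_sqrD (x y : C) : 0 <= x -> 0 <= y -> x * y <= x ^+ 2 + y ^+ 2.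
Proof.
move=> x0 y0; apply: (@le_trans _ _ (x * y + x * y)).
  by rewrite lerDl mulr_ge0.
rewrite -subr_ge0 (_ : _ - _ = (x - y) ^+ 2); last by ring.
by rewrite real_exprn_even_ge0 // rpredB ?ger0_real.
Qed.

Lemma series_lin_cvg (k : C) a b (l1 l2 : C) :
  series a @ \oo --> l1 -> series b @ \oo --> l2 ->
  series (fun n => k * a n + b n) @ \oo --> k * l1 + l2.
Proof.
move=> h1 h2.
have -> : series (fun n => k * a n + b n) =
    (fun n => k * series a n + series b n).
  by apply/funext => n; rewrite /series /= big_split /= mulr_sumr.
exact: cvgcD (cvgcMl k h1) h2.
Qed.

Lemma square_summableP (k : C) a b :
  square_summable a -> square_summable b ->
  square_summable (fun n => k * a n + b n).
Proof.
move=> /cvgc_ex[l1 sa] /cvgc_ex[l2 sb].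
apply: (@series_dom_cvg _ _
    (fun n => 2 * `|k| ^+ 2 * `|a n| ^+ 2 + (1 * `|b n| ^+ 2 + `|b n| ^+ 2))).
  move=> n; rewrite ger0_norm ?exprn_ge0 //=.
  rewrite [leRHS](_ : _ = 2 * (`|k| * `|a n|) ^+ 2 + 2 * `|b n| ^+ 2);
    last by ring.
  apply: (@le_trans _ _ ((`|k * a n| + `|b n|) ^+ 2)).
    by rewrite ler_sqr ?nnegrE ?addr_ge0 // ler_normD.
  by rewrite normrM ler_sqrD2 ?mulr_ge0.
have h1 := @series_lin_cvg 1 _ _ _ _ sb sb.
have h2 := @series_lin_cvg (2 * `|k| ^+ 2) _ _ _ _ sa h1.
by apply/cvgc_ex; eexists; exact: h2.
Qed.

Lemma square_summable_shift a :
  square_summable a <-> square_summable (fun n => a n.+1).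
Proof.
rewrite /square_summable.
have E n : series (fun n => `|a n| ^+ 2) n.+1 =
    `|a 0| ^+ 2 + series (fun n => `|a n.+1| ^+ 2) n.
  by rewrite /series /= big_nat_recl.
split=> /cvgc_ex[l h]; apply/cvgc_ex.
  exists (l - `|a 0%N| ^+ 2).
  move/cvgcS : h => h.
  apply: eq_cvgc (cvgcB h (cvgc_cst _)) => n.
  by rewrite E addrC addKr.
exists (`|a 0%N| ^+ 2 + l); apply/cvgcS.
by apply: eq_cvgc (cvgcD (cvgc_cst _) h) => n; rewrite E.
Qed.

Lemma square_summable_mul a b :
  square_summable a -> square_summable b ->
  cvgn (series (fun n => a n * (b n)^*)).
Proof.
move=> sa sb.
apply: (@series_dom_cvg _ _
    (fun n => 1 * `|a n| ^+ 2 + `|b n| ^+ 2)); last first.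
  move: sa sb => /cvgc_ex[l1 sa] /cvgc_ex[l2 sb]; apply/cvgc_ex.
  by eexists; exact: (@series_lin_cvg 1 _ _ _ _ sa sb).
move=> n; rewrite mul1r normrM norm_conjC.
by rewrite ler_mul_sqrD.
Qed.

Lemma square_summable_bounded a :
  square_summable a -> exists M : C, forall n, `|a n| <= M.
Proof.
move=> /cvgc_ex[l al]; exists (1 + l) => n.
have h : `|a n| ^+ 2 <= l.
  apply: cvgc_ge al; near=> N.
  rewrite /series /= big_mkord.
  have nN : (n < N)%N by near: N; exists n.+1.
  by rewrite (bigD1 (Ordinal nN)) //= lerDl sumr_ge0 //.
apply: le_trans (lerD (lexx 1) h).
have [x1|x1] := real_leP (normr_real (a n)) (@real1 C).
  by rewrite (le_trans x1) // lerDl exprn_ge0.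
by rewrite (@le_trans _ _ (`|a n| ^+ 2)) ?lerDr // ler_eXnr // ltW.
Unshelve. all: by end_near. Qed.

Lemma series_shift_mulX a (z : C) n :
  series (fun n => a n * z ^+ n) n.+1 =
  a 0 + z * series (fun n => a n.+1 * z ^+ n) n.
Proof.
rewrite /series /= big_nat_recl // expr0 mulr1 mulr_sumr; congr (_ + _).
by apply: eq_bigr => i _; rewrite exprS; ring.
Qed.

(* only z != 0 is assumed, so that the hypothesis survives division by z *)
Lemma pseries0_coef0 a :
  (exists M : C, forall n, `|a n| <= M) ->
  (forall z : C, 0 < `|z| < 1 ->
     series (fun n => a n * z ^+ n) @ \oo --> (0 : C)) ->
  a 0 = 0.
Proof.
move=> [M aM] a0; have M0 : 0 <= M := le_trans (normr_ge0 _) (aM 0).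
pose e : C := `|a 0%N|.
apply/eqP; rewrite -normr_eq0 -/e; apply/negPn/negP => e0.
have {}e0 : 0 < e by rewrite lt_def e0 /= normr_ge0.
pose z : C := e / (4 * M + 2 * e).
have d0 : 0 < 4 * M + 2 * e.
  by rewrite ltr_wpDl ?mulr_gt0 ?mulr_ge0.
have z0 : 0 < z by rewrite divr_gt0.
have z12 : z <= 2^-1.
  rewrite ler_pdivrMr // [leRHS](_ : _ = 2 * M + e); last by field.
  by rewrite lerDr mulr_ge0.
have z1 : z < 1 by rewrite (le_lt_trans z12) // invf_lt1 // ltr1n.
have zN : `|z| = z by rewrite gtr0_norm.
have := a0 z; rewrite zN z0 z1 => /(_ isT) /cvgcS h.
have bnd n : `|series (fun n => a n.+1 * z ^+ n) n| <= 2 * M.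
  rewrite /series /=; apply: le_trans (ler_norm_sum _ _ _) _.
  apply: (@le_trans _ _ (\sum_(0 <= k < n) M * (2^-1) ^+ k)).
    apply: ler_sum => k _; rewrite normrM normrX zN ler_pM //.
      by rewrite exprn_ge0 // ltW.
    by rewrite lerXn2r // nnegrE ?invr_ge0 // ltW.
  rewrite -mulr_sumr mulrC ler_wpM2r // big_mkord.
  have := subrX1 (2^-1 : C) n.
  move=> H; have {}H : \sum_(i < n) (2^-1 : C) ^+ i = 2 * (1 - 2^-1 ^+ n).
    have -> : 1 - 2^-1 ^+ n = (2^-1 : C) * \sum_(i < n) (2^-1 : C) ^+ i.
      rewrite -[LHS]opprB H -mulNr; congr (_ * _).
      by field.
    by rewrite mulrA mulfV ?mul1r // pnatr_eq0.
  by rewrite H -[leRHS]mulr1 ler_pM2l // gerBl exprn_ge0 // invr_ge0.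
have h2 : (fun n => series (fun n => a n * z ^+ n) n.+1 - a 0%N) @ \oo --> - a 0%N.
  rewrite -[X in _ --> X]add0r; exact: (cvgcB h (cvgc_cst _)).
have : e <= z * (2 * M).
  rewrite /e -normrN; have /cvg_norm h3 := h2.
  apply: cvgc_le h3; apply: nearW => n.
  rewrite series_shift_mulX addrC addKr normrM zN ler_pM2l //.
apply/negP; rewrite -real_ltNge ?ger0_real ?mulr_ge0 ?(ltW z0) ?(ltW e0) ?invr_ge0 ?(ltW d0) //.
rewrite /z mulrAC ltr_pdivrMr // ltr_pM2l //.
rewrite -subr_gt0 (_ : _ - _ = 2 * M + 2 * e); last by ring.
by rewrite ltr_wpDl ?mulr_gt0 ?mulr_ge0.
Qed.

Lemma pseries0_coef a :
  square_summable a ->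
  (forall z : C, `|z| < 1 ->
     series (fun n => a n * z ^+ n) @ \oo --> (0 : C)) ->
  forall n, a n = 0.
Proof.
move=> sa aP n.
have {}aP z : 0 < `|z| < 1 -> series (fun n => a n * z ^+ n) @ \oo --> (0 : C).
  by move=> /andP[_]; exact: aP.
elim: n a sa aP => [|n IHn] a sa aP.
  by apply: pseries0_coef0 => //; exact: square_summable_bounded.
have a0 : a 0 = 0.
  by apply: pseries0_coef0 => //; exact: square_summable_bounded.
have sa' := (square_summable_shift a).1 sa.
have aP' z : 0 < `|z| < 1 ->
    series (fun n => a n.+1 * z ^+ n) @ \oo --> (0 : C).
  move=> z01; have z0 : z != 0 by rewrite -normr_gt0; case/andP: z01.
  move: (aP z z01) => /cvgcS h.
  move: (cvgcMl z^-1 h); rewrite mulr0.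
  apply: eq_cvgc => k.
  by rewrite series_shift_mulX a0 add0r mulrA mulVf // mul1r.
exact: IHn sa' aP'.
Qed.

End SquareSummable.
Arguments series_lin_cvg {R} k {a b l1 l2}.


Section DotNorm.
Variables (C : numClosedFieldType) (V : lmodType C).
Variable dot : {dot V for Num.conj}.
Local Notation "''[' u , v ]" := (dot u%R v%R) : ring_scope.
Local Notation "''[' u ]" := '[u, u] : ring_scope.

Definition dot_norm (u : V) : C := sqrtC '[u].

Lemma dot_CauchySchwarz (u v : V) : `|'[u, v]| <= dot_norm u * dot_norm v.
Proof.
rewrite /dot_norm -sqrtCM ?nnegrE ?dnorm_ge0 //.
rewrite -(sqrCK (normr_ge0 _)) ler_sqrtC ?nnegrE ?exprn_ge0 ?mulr_ge0 ?dnorm_ge0 //.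
have [->|v0] := eqVneq v 0.
  by rewrite !linear0r normr0 expr0n.
have vv0 : 0 < '[v] by rewrite dnorm_gt0.
pose a := '[u, v] / '[v]; pose w := u - a *: v.
have wv : '[w, v] = 0.
  by rewrite linearBl /= linearZl_LR /= divfK ?dnorm_eq0 // subrr.
have uE : u = w + a *: v by rewrite subrK.
rewrite uE linearDl /= wv add0r linearZl_LR /= normrM (ger0_norm (dnorm_ge0 _ _)).
rewrite exprMn hnormDd /=; last by rewrite linearZr_LR /= wv mulr0.
by rewrite dnormZ mulrDl expr2 mulrA lerDr mulr_ge0 // dnorm_ge0.
Qed.

Lemma dot_normD (u v : V) : dot_norm (u + v) <= dot_norm u + dot_norm v.
Proof.
rewrite -ler_sqr ?nnegrE ?addr_ge0 ?sqrtC_ge0 ?dnorm_ge0 //.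
rewrite sqrrD !sqrtCK addrAC dnormD lerD2l.
have := leif_Re_Creal '[u, v] => -[h _].
have := le_trans h (dot_CauchySchwarz u v).
rewrite ReE ler_pdivrMr ?ltr0n // => /le_trans -> //.
by rewrite mulr_natr.
Qed.

Lemma dot_normZ (k : C) (u : V) : dot_norm (k *: u) = `|k| * dot_norm u.
Proof.
by rewrite /dot_norm dnormZ sqrtCM ?nnegrE ?exprn_ge0 ?dnorm_ge0 // sqrCK.
Qed.

Lemma dot_norm_eq0 (u : V) : dot_norm u = 0 -> u = 0.
Proof. by move/eqP; rewrite sqrtC_eq0 dnorm_eq0 => /eqP. Qed.

End DotNorm.

Definition disc (R : realType) := {z : R[i] | `|z| < 1}.

(* f(z) = \sum_n a_n z^n on the disc, with square-summable coefficients *)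
Definition taylor_coefs (R : realType) (f : disc R -> R[i]) (a : nat -> R[i]) :=
  square_summable a /\
  forall z : disc R, series (fun n => a n * val z ^+ n) @ \oo --> f z.

Definition hardy_pred (R : realType) : {pred disc R -> R[i]} :=
  fun f => `[< exists a, taylor_coefs f a >].

Record hardy (R : realType) := Hardy {
  hardy_fun :> disc R -> R[i];
  hardy_funP : hardy_fun \in @hardy_pred R }.

HB.instance Definition _ (R : realType) := [isSub for @hardy_fun R].
HB.instance Definition _ (R : realType) := [Choice of hardy R by <:].

Lemma hardy_predP (R : realType) (f : disc R -> R[i]) :
  reflect (exists a, taylor_coefs f a) (f \in @hardy_pred R).
Proof. exact: asboolP. Qed.

Lemma taylor_coefsP (R : realType) (k : R[i]) (f g : disc R -> R[i]) a b :
  taylor_coefs f a -> taylor_coefs g b ->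
  taylor_coefs (k *: f + g) (fun n => k * a n + b n).
Proof.
move=> [sa fa] [sb gb]; split; first exact: square_summableP.
move=> z; apply: eq_cvg_series (series_lin_cvg k (fa z) (gb z)) => n /=; ring.
Qed.

Lemma hardy_submod (R : realType) : GRing.submod_closed (@hardy_pred R).
Proof.
split.
  apply/hardy_predP; exists (fun=> 0); split; first exact: square_summable0.
  move=> z; apply: eq_cvgc (cvgc_cst 0) => n.
  by rewrite /series /= big1 // => i _; rewrite mul0r.
move=> k f g /hardy_predP[a fa] /hardy_predP[b gb]; apply/hardy_predP.
by exists (fun n => k * a n + b n); exact: taylor_coefsP.
Qed.

HB.instance Definition _ (R : realType) :=
  GRing.isSubmodClosed.Build R[i] (disc R -> R[i]) (@hardy_pred R)
    (@hardy_submod R).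
HB.instance Definition _ (R : realType) :=
  [SubChoice_isSubLmodule of hardy R by <:].

Section HardyInner.
Variable R : realType.
Local Notation C := R[i].
Local Notation H2 := (hardy R).
Implicit Types (f g h : H2).

Lemma hardy_coefs_ex f : exists a, taylor_coefs f a.
Proof. exact/hardy_predP/hardy_funP. Qed.

Definition hardy_coef f : nat -> C := sval (cid (hardy_coefs_ex f)).

Lemma hardy_coefP f : taylor_coefs f (hardy_coef f).
Proof. exact: (svalP (cid (hardy_coefs_ex f))). Qed.

Lemma taylor_coefs_uniq (f : disc R -> C) a b :
  taylor_coefs f a -> taylor_coefs f b -> a = b.
Proof.
move=> fa fb; have [sab ab0] := taylor_coefsP (-1) fa fb.
apply/funext => n; apply/eqP; rewrite eq_sym -subr_eq0; apply/eqP.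
have := pseries0_coef sab _ n; rewrite mulN1r addrC; apply => z z1.
have := ab0 (exist _ z z1 : disc R).
by rewrite scaleN1r addNr.
Qed.

Lemma hardy_coefE f a : taylor_coefs f a -> hardy_coef f = a.
Proof. by move=> fa; exact: taylor_coefs_uniq (hardy_coefP f) fa. Qed.

Lemma hardy_coef_lin (k : C) f g n :
  hardy_coef (k *: f + g) n = k * hardy_coef f n + hardy_coef g n.
Proof.
have := taylor_coefsP k (hardy_coefP f) (hardy_coefP g).
by move/(@hardy_coefE (k *: f + g)) => ->.
Qed.

Lemma hardy_coef_eq0 f : (forall n, hardy_coef f n = 0) -> f = 0.
Proof.
move=> f0; apply: val_inj; apply/funext => z /=.
have [_ /(_ z) h] := hardy_coefP f.
apply: (cvgc_unique h).
apply: eq_cvgc (cvgc_cst 0) => n.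
by rewrite /series /= big1 // => i _; rewrite f0 mul0r.
Qed.

Definition hardy_dot f g : C :=
  limn (series (fun n => hardy_coef f n * (hardy_coef g n)^*)).

Lemma hardy_dot_cvg f g :
  series (fun n => hardy_coef f n * (hardy_coef g n)^*) @ \oo --> hardy_dot f g.
Proof.
by apply: square_summable_mul; [case: (hardy_coefP f)|case: (hardy_coefP g)].
Qed.

Lemma hardy_dotE f g (l : C) :
  series (fun n => hardy_coef f n * (hardy_coef g n)^*) @ \oo --> l ->
  hardy_dot f g = l.
Proof. by move=> h; exact: cvgc_unique (@hardy_dot_cvg f g) h. Qed.

Lemma hardy_dotC f g : hardy_dot f g = (hardy_dot g f)^*.
Proof.
apply: hardy_dotE; apply: eq_cvgc (cvg_conjc (@hardy_dot_cvg g f)) => n.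
rewrite /series /= rmorph_sum; apply: eq_bigr => i _.
by rewrite rmorphM /= conjCK mulrC.
Qed.

Lemma hardy_dot_linl (k : C) f g h :
  hardy_dot (k *: f + g) h = k * hardy_dot f h + hardy_dot g h.
Proof.
apply: hardy_dotE.
apply: eq_cvg_series
  (series_lin_cvg k (@hardy_dot_cvg f h) (@hardy_dot_cvg g h)) => n.
rewrite hardy_coef_lin /=; set x := hardy_coef f n; set y := hardy_coef g n.
by rewrite mulrDl mulrA.
Qed.

Lemma hardy_dot_bilinear :
  bilinear_for ( *%R : C -> C -> C) (Num.conj \; *%R) hardy_dot.
Proof.
split=> [h k f g|h k f g] /=; first exact: hardy_dot_linl.
rewrite (hardy_dotC h (k *: f + g)) (hardy_dotC h f) (hardy_dotC h g).
by rewrite hardy_dot_linl rmorphD rmorphM.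
Qed.

HB.instance Definition _ := bilinear_isBilinear.Build C H2 H2 C
  *%R (Num.conj \; *%R) hardy_dot hardy_dot_bilinear.

Lemma hardy_dot_hermitian f g :
  hardy_dot f g = (-1) ^+ false * (hardy_dot g f)^*.
Proof. by rewrite expr0 mul1r hardy_dotC. Qed.

HB.instance Definition _ := isHermitianSesquilinear.Build C H2
  false Num.conj hardy_dot hardy_dot_hermitian.

Lemma hardy_dot_gt0 f : f != 0 -> 0 < hardy_dot f f.
Proof.
move=> f0.
have [n fn0] : exists n, hardy_coef f n != 0.
  apply/not_existsP => h; move/eqP : f0; apply; apply: hardy_coef_eq0 => n.
  by apply/eqP/negPn/negP; exact: h.
apply: (@lt_le_trans _ _ (`|hardy_coef f n| ^+ 2)).
  by rewrite exprn_gt0 // normr_gt0.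
apply: cvgc_ge (@hardy_dot_cvg f f); near=> N.
have nN : (n < N)%N by near: N; exists n.+1.
rewrite /series /= big_mkord (bigD1 (Ordinal nN)) //= normCK lerDl.
by rewrite sumr_ge0 // => i _; exact: mul_conjC_ge0.
Unshelve. all: by end_near. Qed.

HB.instance Definition _ := isDotProduct.Build C H2 hardy_dot hardy_dot_gt0.

HB.instance Definition _ := Lmodule_isNormed.Build C H2
  (dot_normD hardy_dot) (dot_normZ hardy_dot) (@dot_norm_eq0 _ _ hardy_dot).

Lemma hardy_normE f : `|f| = sqrtC (hardy_dot f f).
Proof. by []. Qed.

End HardyInner.


Definition closed_subspace (K : numFieldType) (V : normedModType K)
    (M : set V) :=
  GRing.submod_closed (mem M) /\ closed M.

Section AlmostInvariance.
Variables (C : numClosedFieldType) (V : lmodType C).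
Variable dot : {dot V for Num.conj}.
Implicit Types (T : V -> V) (M F : set V).

(* [adjoint T y] is the h, unique by positive definiteness, that represents the
   functional x |-> dot (T x) y, and 0 if there is none; Tz_starP below shows
   that it exists for Tz *)
Definition adjoint T (y : V) : V :=
  xget 0 [set h | forall x, dot (T x) y = dot x h].

Definition tensor (u v : V) : V -> V := fun f => dot f v *: u.

Definition invariant_under T M := T @` M `<=` M.

Definition lin_span n (e : n.-tuple V) : set V :=
  [set x | exists c : 'I_n -> C, x = \sum_(i < n) c i *: tnth e i].

Definition lin_indep n (e : n.-tuple V) :=
  forall c : 'I_n -> C, \sum_(i < n) c i *: tnth e i = 0 -> forall i, c i = 0.

Definition has_dim n F :=
  exists e : n.-tuple V, lin_indep e /\ F = lin_span e.

Definition has_rank n T := has_dim n (range T).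

Definition orthonormal_basis n (e : n.-tuple V) F :=
  orthonormal dot e /\ F = lin_span e.

Definition perp M F := forall x y, M x -> F y -> dot x y = 0.

(* T M is contained in the orthogonal direct sum of M and F *)
Definition maps_into_oplus T M F :=
  perp M F /\ T @` M `<=` [set x + y | x in M & y in F].

Definition almost_invariant T M :=
  exists n F, has_dim n F /\ maps_into_oplus T M F.

Definition has_defect T M d :=
  (exists F, has_dim d F /\ maps_into_oplus T M F) /\
  (forall n F, has_dim n F -> maps_into_oplus T M F -> (d <= n)%N).

Definition defect_space T M F :=
  maps_into_oplus T M F /\ exists d, has_defect T M d /\ has_dim d F.

End AlmostInvariance.

Section Shift.
Variable R : realType.
Local Notation C := R[i].
Local Notation H2 := (hardy R).
Implicit Types (f g h : H2).

Lemma disc_series_cvg (a : nat -> C) (z : C) :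
  square_summable a -> `|z| < 1 -> cvgn (series (fun n => a n * z ^+ n)).
Proof.
move=> sa z1.
have [r zr] : exists r : R, `|z| = r%:C%C.
  by exists (complex.Re `|z|); rewrite RRe_real // normr_real.
have r0 : 0 <= r by have := normr_ge0 z; rewrite zr lecR.
have r1 : r < 1 by move: z1; rewrite zr ltcR.
have hr : `|r ^+ 2| < 1 by rewrite ger0_norm ?exprn_ge0 // exprn_ilt1.
have h := @cvg_geometric_series R 1 (r ^+ 2) hr.
have sz : square_summable (fun n => z ^+ n).
  apply/cvgc_ex; eexists.
  apply: eq_cvgc (cvg_real_complex h) => n.
  rewrite /series /= rmorph_sum; apply: eq_bigr => i _.
  by rewrite normrX zr /= mul1r -exprM mulnC exprM !rmorphXn.
move: sa sz => /cvgc_ex[l1 sa] /cvgc_ex[l2 sz].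
apply: (@series_dom_cvg _ _ (fun n => 1 * `|a n| ^+ 2 + `|z ^+ n| ^+ 2)).
  by move=> n; rewrite mul1r normrM ler_mul_sqrD.
by apply/cvgc_ex; eexists; exact: (series_lin_cvg 1 sa sz).
Qed.

Lemma hardy_of_coef (a : nat -> C) :
  square_summable a -> exists f, hardy_coef f = a.
Proof.
move=> sa.
pose F (z : disc R) : C := limn (series (fun n => a n * val z ^+ n)).
have Fa : taylor_coefs F a.
  split; first exact: sa.
  move=> z; exact: (disc_series_cvg sa (valP z)).
have FP : F \in @hardy_pred R by apply/hardy_predP; exists a.
by exists (Hardy FP); exact: hardy_coefE.
Qed.

Lemma taylor_coefs_mulz (f : disc R -> C) a : taylor_coefs f a ->
  taylor_coefs (fun z => val z * f z) (fun n => if n is k.+1 then a k else 0).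
Proof.
move=> [sa fa]; split; first exact/square_summable_shift.
move=> z; apply/cvgcS; apply: eq_cvgc (cvgcMl (val z) (fa z)) => n.
by rewrite series_shift_mulX add0r.
Qed.

Lemma mulz_hardy f : (fun z : disc R => val z * f z) \in @hardy_pred R.
Proof.
apply/hardy_predP; eexists; exact: taylor_coefs_mulz (hardy_coefP f).
Qed.

Definition Tz f : H2 := Hardy (mulz_hardy f).

Lemma hardy_coef_Tz f n :
  hardy_coef (Tz f) n = if n is k.+1 then hardy_coef f k else 0.
Proof.
by rewrite (@hardy_coefE _ (Tz f) _ (taylor_coefs_mulz (hardy_coefP f))).
Qed.

Lemma hardy_dot_Tz f g h :
  (forall n, hardy_coef h n = hardy_coef g n.+1) ->
  hardy_dot (Tz f) g = hardy_dot f h.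
Proof.
move=> hg; apply: hardy_dotE; apply/cvgcS.
apply: eq_cvgc (@hardy_dot_cvg _ f h) => n.
rewrite /series /= big_nat_recl // hardy_coef_Tz mul0r add0r.
by apply: eq_bigr => i _; rewrite hardy_coef_Tz hg.
Qed.

Definition Tz_star : H2 -> H2 := adjoint (@hardy_dot R) Tz.

Lemma Tz_starP f g : hardy_dot (Tz f) g = hardy_dot f (Tz_star g).
Proof.
have [sg _] := hardy_coefP g.
have /hardy_of_coef[h hg] := (square_summable_shift _).1 sg.
rewrite /Tz_star /adjoint; case: xgetP => [_ _ ->//|/(_ h) []].
by move=> x; apply: hardy_dot_Tz => n; rewrite hg.
Qed.

Lemma hardy_coef_Tz_star g n :
  hardy_coef (Tz_star g) n = hardy_coef g n.+1.
Proof.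
have [sg _] := hardy_coefP g.
have /hardy_of_coef[h hg] := (square_summable_shift _).1 sg.
rewrite -[RHS](congr1 (fun u => u n) hg).
suff -> : Tz_star g = h by [].
apply/eqP; rewrite -subr_eq0 -(dnorm_eq0 (@hardy_dot R)) linearBr /=.
rewrite -Tz_starP (@hardy_dot_Tz _ _ h) ?subrr // => i.
by rewrite hg.
Qed.

End Shift.

(* Main.v *)
(* If S = T - sum v_i (x) u_i maps M into itself, then T x = S x + sum <x, u_i> v_i
   for x in M, and subtracting from each v_i its projection onto M moves the
   finite sum into M + F, where F is spanned by the vectors v_i - P v_i
   (P exists because M is closed and H^2 is complete).
   Conversely, if T_z^* x = y + z with y in M and z in F, F orthogonal to M, then
   the coordinates of z are <z, f_i> = <T_z^* x, f_i> = <x, T_z f_i>, so that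
   subtracting sum f_i (x) T_z f_i leaves y.  Since T_z is an isometry, this
   perturbation has rank exactly m. *)
Require Import Defs.
From HB Require Import structures.
From mathcomp Require Import all_boot all_order all_algebra sesquilinear.
From mathcomp Require Import complex ring lra.
From mathcomp Require Import all_classical all_reals all_analysis.
Set Implicit Arguments.
Unset Strict Implicit.
Unset Printing Implicit Defensive.
Import Order.TTheory GRing.Theory Num.Theory.
Import numFieldNormedType.Exports.
Local Open Scope ring_scope.
Local Open Scope classical_set_scope.

(** * Spans of finite tuples and their dimension *)

Section Span.
Variables (C : numClosedFieldType) (V : lmodType C).

Lemma lin_span_cons n (x : V) (e : n.-tuple V) y :
  lin_span [tuple of x :: e] y <-> exists k z, lin_span e z /\ y = k *: x + z.
Proof.
split=> [[c ->]|[k [z [[c ->] ->]]]].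
  rewrite big_ord_recl; exists (c ord0); eexists; split; last reflexivity.
  by exists (fun i => c (lift ord0 i)); apply: eq_bigr => i _; rewrite tnthS.
exists (fun i => if unlift ord0 i is Some j then c j else k).
rewrite big_ord_recl unlift_none; congr (_ + _).
by apply: eq_bigr => i _; rewrite liftK tnthS.
Qed.

Lemma lin_span_lin n (e : n.-tuple V) k x y :
  lin_span e x -> lin_span e y -> lin_span e (k *: x + y).
Proof.
move=> [c ->] [d ->]; exists (fun i => k * c i + d i).
rewrite scaler_sumr -big_split; apply: eq_bigr => i _ /=.
by rewrite scalerA scalerDl.
Qed.

Lemma lin_indep_cons n (x : V) (e : n.-tuple V) :
  lin_indep e -> ~ lin_span e x -> lin_indep [tuple of x :: e].
Proof.
move=> ie xe c; rewrite big_ord_recl tnth0.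
under eq_bigr do rewrite tnthS.
have [c0|c0 /eqP] := eqVneq (c ord0) 0.
  rewrite c0 scale0r add0r => h i; case: (unliftP ord0 i) => [j|] -> //.
  exact: ie h j.
rewrite addr_eq0 => /eqP h; case: xe.
exists (fun i => - (c ord0)^-1 * c (lift ord0 i)).
under eq_bigr do rewrite mulNr scaleNr -scalerA.
by rewrite sumrN -scaler_sumr -scalerN -h scalerA mulVf // scale1r.
Qed.

(** The entries of [e] may be dependent or zero, so the length only bounds the dimension. By
    induction, the head joins the basis found for the tail exactly when it lies outside its span. *)
Lemma lin_span_dim n (e : n.-tuple V) :
  exists d, (d <= n)%N /\ has_dim d (lin_span e).
Proof.
elim: n e => [|n IHn] e.
  by exists 0%N; split=> //; exists e; split=> // c _ [].
case/tupleP: e => x e; have [d [dn [b [ib eb]]]] := IHn e.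
have [xb|xb] := pselect (lin_span b x); last first.
  exists d.+1; split=> //; exists [tuple of x :: b].
  split; first exact: lin_indep_cons.
  by apply/seteqP; split=> y /lin_span_cons h; apply/lin_span_cons; move: h;
    rewrite eb.
exists d; split; first exact: leqW.
exists b; split=> //; apply/seteqP; split=> y.
  by move=> /lin_span_cons[k [z []]]; rewrite eb => zb ->; exact: lin_span_lin.
move=> yb; apply/lin_span_cons; exists 0, y; split; first by rewrite eb.
by rewrite scale0r add0r.
Qed.

End Span.

(** * Defects and finite-rank perturbations for an abstract inner product *)

Section Defect.
Variables (C : numClosedFieldType) (V : lmodType C).
Variable dot : {dot V for Num.conj}.
Implicit Types (T : V -> V) (M F : set V).

Lemma orthonormal_tnth n (f : n.-tuple V) i j :
  orthonormal dot f -> dot (tnth f i) (tnth f j) = (i == j)%:R.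
Proof.
move=> /orthonormalP[uf ->]; rewrite ?mem_tnth //.
by rewrite (inj_eq (elimT (tuple_uniqP f) uf)).
Qed.

Lemma dot_sum_orthonormal n (f : n.-tuple V) (c : 'I_n -> C) i :
  orthonormal dot f -> dot (\sum_(j < n) c j *: tnth f j) (tnth f i) = c i.
Proof.
move=> of_; rewrite linear_sumlz (bigD1 i) //= linearZl_LR /=.
rewrite orthonormal_tnth // eqxx mulr1 big1 ?addr0 // => j ji.
by rewrite linearZl_LR /= orthonormal_tnth // (negPf ji) mulr0.
Qed.

Lemma orthonormal_lin_indep n (f : n.-tuple V) :
  orthonormal dot f -> lin_indep f.
Proof.
move=> of_ c c0 i; rewrite -(dot_sum_orthonormal c i of_) c0 linear0l //.
Qed.

(** One admissible space makes the set of admissible dimensions nonempty, and its least element is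
    the defect. *)
Lemma has_defect_le T M n F :
  has_dim n F -> maps_into_oplus dot T M F ->
  exists d, has_defect dot T M d /\ (d <= n)%N.
Proof.
move=> dF TF; pose P d := `[< exists F, has_dim d F /\ maps_into_oplus dot T M F >].
have exP : exists d, P d by exists n; apply/asboolP; exists F.
case: (ex_minnP exP) => d /asboolP Pd dmin; exists d; split.
  by split=> // k G dG TG; apply: dmin; apply/asboolP; exists G.
by apply: dmin; apply/asboolP; exists F.
Qed.

Lemma sum_tensorE n (u v : n.-tuple V) x :
  (\sum_(i < n) tensor dot (tnth v i) (tnth u i)) x =
  \sum_(i < n) dot x (tnth u i) *: tnth v i.
Proof. by rewrite fct_sumE. Qed.

Lemma submod_closed_sum M n (c : 'I_n -> C) (p : 'I_n -> V) :
  GRing.submod_closed (mem M) -> (forall i, M (p i)) ->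
  M (\sum_(i < n) c i *: p i).
Proof.
move=> [M0 MD] Mp; apply: (big_ind M); first by have := set_mem M0.
  by move=> x y Mx My; rewrite -[x]scale1r; apply/set_mem/MD; exact/mem_set.
move=> i _; rewrite -[_ *: _]addr0; apply/set_mem/MD; last exact: M0.
exact/mem_set.
Qed.

(** The [p i] stand for the projections of the [v_i] onto [M], kept abstract so that no completeness
    enters here. *)
Lemma invariant_maps_into_oplus T M n (u v : n.-tuple V) (p : 'I_n -> V) :
  GRing.submod_closed (mem M) ->
  (forall i, M (p i)) ->
  (forall i x, M x -> dot (tnth v i - p i) x = 0) ->
  invariant_under (T - \sum_(i < n) tensor dot (tnth v i) (tnth u i)) M ->
  maps_into_oplus dot T M (lin_span [tuple tnth v i - p i | i < n]).
Proof.
move=> sM Mp pv inv; split.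
  move=> x _ Mx [c ->]; rewrite linear_sumr big1 // => i _.
  by rewrite linearZr_LR /= tnth_mktuple hermC /= pv // conjC0 mulr0 mulr0.
(* The component in [M] is the perturbed operator at [x] plus the sum of [<x, u_i> p_i]; the one in
   [F] is the sum of [<x, u_i> (v_i - p_i)]. *)
move=> _ [x Mx <-]; exists ((T x - \sum_(i < n) dot x (tnth u i) *: tnth v i) +
  \sum_(i < n) dot x (tnth u i) *: p i).
  rewrite -[X in X + _]scale1r; apply/set_mem/sM.2; apply/mem_set.
    by apply: inv; exists x => //; rewrite /= -sum_tensorE.
  exact: submod_closed_sum.
exists (\sum_(i < n) dot x (tnth u i) *: tnth [tuple tnth v i - p i | i < n] i).
  by eexists.
rewrite -addrA -big_split /= [X in _ + X](_ : _ =
  \sum_(i < n) dot x (tnth u i) *: tnth v i) ?subrK //.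
by apply: eq_bigr => i _; rewrite tnth_mktuple -scalerDr addrC subrK.
Qed.

(** [Tadj] enters only through its duality identity, so that [Tz_star] can serve as [T] with [Tz] as
    its adjoint. *)
Lemma maps_into_oplus_invariant T Tadj M n (f : n.-tuple V) :
  (forall x y, dot (T x) y = dot x (Tadj y)) ->
  orthonormal dot f -> maps_into_oplus dot T M (lin_span f) ->
  invariant_under
    (T - \sum_(i < n) tensor dot (tnth f i) (Tadj (tnth f i))) M.
Proof.
move=> TA of_ [MF TM] _ [x Mx <-].
have [y My [z [c zE] Txy]] : [set x + y | x in M & y in lin_span f] (T x).
  by apply: TM; exists x.
suff -> : (T - \sum_(i < n) tensor dot (tnth f i) (Tadj (tnth f i))) x = y by [].
have -> : (T - \sum_(i < n) tensor dot (tnth f i) (Tadj (tnth f i))) x =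
  T x - (\sum_(i < n) tensor dot (tnth f i) (Tadj (tnth f i))) x by [].
have ff i : lin_span f (tnth f i).
  exists (fun j => (j == i)%:R); rewrite (bigD1 i) //= eqxx scale1r big1 ?addr0 //.
  by move=> j /negPf ->; rewrite scale0r.
rewrite fct_sumE (eq_bigr (fun i => c i *: tnth f i)) => [|i _].
  by rewrite -zE -Txy addrK.
rewrite /tensor -TA -Txy linearDl /= (MF _ _ My (ff i)) add0r zE.
by rewrite dot_sum_orthonormal.
Qed.

(** Orthonormality of [g] makes every coefficient vector attainable: the sum of [c_i g_i] is sent to
    the sum of [c_i f_i], so the range is the whole span of [f]. *)
Lemma has_rank_tensor n (f g : n.-tuple V) :
  orthonormal dot f -> orthonormal dot g ->
  has_rank n (\sum_(i < n) tensor dot (tnth f i) (tnth g i)).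
Proof.
move=> of_ og; exists f; split; first exact: orthonormal_lin_indep.
apply/seteqP; split=> [_ [x _ <-]|_ [c ->]].
  by rewrite sum_tensorE; eexists.
exists (\sum_(i < n) c i *: tnth g i) => //; rewrite sum_tensorE.
by apply: eq_bigr => i _; rewrite dot_sum_orthonormal.
Qed.

End Defect.

(** * Orthogonal projection by distance minimization *)

Section Projection.
Variables (R : realType) (V : lmodType R[i]).
Local Notation C := R[i].
Variable dot : {dot V for Num.conj}.
Implicit Types (f g w x : V) (M : set V).

(** The squared norm is taken in [R] rather than [R[i]], where infima and linear arithmetic are
    available. *)
Definition dot_sqr f : R := complex.Re (dot f f).

Lemma dot_sqrE f : (dot_sqr f)%:C%C = dot f f.
Proof. by rewrite RRe_real // ger0_real // dnorm_ge0. Qed.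

Lemma dot_sqr_ge0 f : 0 <= dot_sqr f.
Proof. by rewrite -lecR dot_sqrE dnorm_ge0. Qed.

Lemma dot_sqr_parallelogram f g :
  dot_sqr (f + g) + dot_sqr (f - g) = 2 * dot_sqr f + 2 * dot_sqr g.
Proof.
rewrite /dot_sqr dnormD dnormB -raddfD addrACA subrr addr0 !raddfD /=; ring.
Qed.

Lemma dot_sqrZ (k : R) f : dot_sqr (k%:C%C *: f) = k ^+ 2 * dot_sqr f.
Proof.
apply: complexI; rewrite dot_sqrE dnormZ normc_real -rmorphXn.
by rewrite real_normK ?num_real // -dot_sqrE -rmorphM.
Qed.

Lemma dot_CauchySchwarz_sqr f g :
  `|dot f g| ^+ 2 <= (dot_sqr f * dot_sqr g)%:C%C.
Proof.
rewrite rmorphM /= !dot_sqrE -[X in X * _]sqrtCK -[X in _ * X]sqrtCK -exprMn.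
rewrite ler_sqr ?nnegrE ?mulr_ge0 ?sqrtC_ge0 ?dnorm_ge0 //.
exact: dot_CauchySchwarz.
Qed.

(* w is compared with w - c x for the optimal c = <w, x> / <x, x>. *)
Lemma dot_sqr_near_min w x (e : R) :
  (forall c : C, dot_sqr w <= dot_sqr (w - c *: x) + e) ->
  `|dot w x| ^+ 2 <= (e * dot_sqr x)%:C%C.
Proof.
have [->|x0] := eqVneq x 0.
  by move=> _; rewrite /dot_sqr !linear0r normr0 expr0n /= ?mulr0 lexx.
have xx : 0 < dot x x by rewrite dnorm_gt0.
pose c := dot w x / dot x x => /(_ c).
pose z := w - c *: x.
have zx : dot z x = 0.
  by rewrite linearBl /= linearZl_LR /= divfK ?dnorm_eq0 // subrr.
have wE : w = z + c *: x by rewrite subrK.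
have : dot w w = dot z z + `|c| ^+ 2 * dot x x.
  rewrite {1 2}wE hnormDd /=; last by rewrite linearZr_LR /= zx mulr0.
  by rewrite dnormZ.
rewrite -/z -lecR rmorphD /= !dot_sqrE => ->; rewrite lerD2l => ce.
rewrite rmorphM /= dot_sqrE -ler_pdivrMr //.
apply: le_trans ce; rewrite /c normrM normfV (gtr0_norm xx).
rewrite [leRHS](_ : _ = `|dot w x| ^+ 2 / dot x x) //.
by field; rewrite gt_eqF.
Qed.

(** [V] carries no topology in this section, so convergence is spelled out, with [e] bounding the
    squared distance. *)
Definition dot_cvg (p : nat -> V) g := forall e : R, 0 < e ->
  exists N, forall i, (N <= i)%N -> dot_sqr (p i - g) <= e.

Definition dot_cauchy (p : nat -> V) := forall e : R, 0 < e ->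
  exists N, forall i j, (N <= i)%N -> (N <= j)%N -> dot_sqr (p i - p j) <= e.

(* By the parallelogram identity a minimizing sequence for the distance to M is
   Cauchy. *)
Lemma dot_projection M v :
  GRing.submod_closed (mem M) ->
  (forall p, (forall n, M (p n)) -> dot_cauchy p -> exists2 g, M g & dot_cvg p g) ->
  exists p, M p /\ forall x, M x -> dot (v - p) x = 0.
Proof.
move=> [M0 MP] cM; have {}M0 : M 0 by exact: set_mem M0.
have {}MP k x y : M x -> M y -> M (k *: x + y).
  by move=> Mx My; apply/set_mem/MP; exact/mem_set.
pose D := [set dot_sqr (v - p) | p in M].
have lbD : has_lbound D by exists 0 => _ [p _ <-]; exact: dot_sqr_ge0.
have infD : has_inf D by split=> //; exists (dot_sqr (v - 0)), 0.
have dD p : M p -> inf D <= dot_sqr (v - p).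
  by move=> Mp; apply: ge_inf => //; exists p.
have e0 n : 0 < n.+1%:R^-1 :> R by rewrite invr_gt0.
have /choice[p pP] n : exists p, M p /\ dot_sqr (v - p) <= inf D + n.+1%:R^-1.
  by have [_ [p Mp <-] /ltW] := inf_adherent (e0 n) infD; exists p.
have pN (e : R) : 0 < e -> exists N, forall n, (N <= n)%N -> n.+1%:R^-1 <= e.
  move=> ep; have [N _ NP] := near_infty_natSinv_lt (PosNum ep).
  by exists N => n Nn; apply/ltW/NP.
have cp : dot_cauchy p.
  (* The squared distance of [p i] and [p j] will be at most [2/(i+1) + 2/(j+1)], hence the
     quarter. *)
  move=> e ep; have e40 : 0 < e / 4 by rewrite divr_gt0.
  have [N NP] := pN _ e40; exists N => i j Ni Nj; have [Mi vi] := pP i; have [Mj vj] := pP j.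
  have mid : (2 : R)%:C%C != 0 :> C by rewrite (inj_eq (@complexI R) _ 0) pnatr_eq0.
  have := dot_sqr_parallelogram (v - p j) (v - p i).
  have -> : v - p j - (v - p i) = p i - p j by rewrite opprB addrC subrKA.
  (* The sum is twice the vector from the midpoint of [p i] and [p j] to [v]; the midpoint is in
     [M], so its squared distance to [v] is at least [inf D]. *)
  have -> : v - p j + (v - p i) =
      (2 : R)%:C%C *: (v - ((2 : R)%:C%C^-1 *: p j + (2 : R)%:C%C^-1 *: p i)).
    rewrite scalerBr scalerDr !scalerA !mulfV // !scale1r rmorph_nat scaler_nat.
    by rewrite mulr2n addrACA opprD.
  rewrite dot_sqrZ; have Mm : M ((2 : R)%:C%C^-1 *: p j + (2 : R)%:C%C^-1 *: p i).
    by apply: (MP _ _ _ Mj); rewrite -[_ *: _]addr0; exact: (MP _ _ _ Mi).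
  move: (dD _ Mm) (NP i Ni) (NP j Nj); move: vi vj; move: (dot_sqr (v - (_ + _))).
  move: (inf D) i.+1%:R^-1 j.+1%:R^-1 => *; lra.
have [g Mg gP] := cM p (fun n => (pP n).1) cp.
exists g; split=> // x Mx.
(* Split [v - g] at a late [p n]. The part [v - p n] is nearly minimal among its translates by
   multiples of [x], the part [p n - g] falls to Cauchy-Schwarz, and [(a + b)^2 <= 2 a^2 + 2 b^2]
   yields the factor 4. *)
have small (e : R) : 0 < e ->
    `|dot (v - g) x| ^+ 2 <= (4 * e * dot_sqr x)%:C%C.
  move=> ep; have [N1 N1P] := pN _ ep; have [N2 N2P] := gP _ ep.
  pose n := maxn N1 N2; have [Mn vn] := pP n.
  have h1 : `|dot (v - p n) x| ^+ 2 <= (e * dot_sqr x)%:C%C.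
    apply: dot_sqr_near_min => c; apply: le_trans vn _; apply: lerD.
      by rewrite -addrA -opprD [_ + c *: x]addrC; apply: dD; exact: MP.
    by apply: N1P; rewrite leq_maxl.
  have h2 : `|dot (p n - g) x| ^+ 2 <= (e * dot_sqr x)%:C%C.
    apply: le_trans (dot_CauchySchwarz_sqr _ _) _.
    by rewrite lecR ler_wpM2r ?dot_sqr_ge0 // N2P // leq_maxr.
  have -> : v - g = (v - p n) + (p n - g) by rewrite addrA subrK.
  rewrite linearDl /=; apply: (@le_trans _ _
      ((`|dot (v - p n) x| + `|dot (p n - g) x|) ^+ 2)).
    by rewrite ler_sqr ?nnegrE ?addr_ge0 // ler_normD.
  apply: le_trans (ler_sqrD2 (normr_ge0 _) (normr_ge0 _)) _.
  have -> : (4 * e * dot_sqr x)%:C%C =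
      2 * (e * dot_sqr x)%:C%C + 2 * (e * dot_sqr x)%:C%C :> C.
    by rewrite -mulrA [in LHS]rmorphM /= rmorph_nat; ring.
  by apply: lerD; rewrite ler_pM2l.
apply/eqP; rewrite -normr_eq0 -sqrf_eq0; set y := `|_| ^+ 2.
have y0 : 0 <= y by rewrite exprn_ge0.
have yE : y = (complex.Re y)%:C%C by rewrite RRe_real // ger0_real.
rewrite eq_le y0 andbT yE (lecR _ 0); apply/ler_addgt0Pr => e ep.
have s0 := dot_sqr_ge0 x.
(* Dividing [e] by this number brings the bound of [small] below [e]; the added 1 keeps it positive
   when [x = 0]. *)
have q0 : 0 < 4 * (1 + dot_sqr x) by lra.
have := small _ (divr_gt0 ep q0); rewrite -/y yE lecR => /le_trans; apply.
rewrite add0r mulrA mulrAC ler_pdivrMr //; nra.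
Qed.

End Projection.

(** * Completeness of the Hardy space, projections in it, and the shift as an isometry *)

Section Hardy.
Variable R : realType.
Local Notation C := R[i].
Local Notation H2 := (hardy R).
Implicit Types (f g h : H2).

Lemma cvgr_cauchy (u : nat -> R) :
  (forall e, 0 < e ->
    exists N, forall i j, (N <= i)%N -> (N <= j)%N -> `|u i - u j| <= e) ->
  cvgn u.
Proof.
move=> cu; apply/cauchy_cvgP/cauchy_ballP => e e0.
(* Halving [e] turns the non-strict Cauchy bound into the strict one of a ball. *)
have [N NP] := cu _ (divr_gt0 e0 (ltr0Sn _ 1)).
exists ([set x | exists2 i, (N <= i)%N & x = u i],
        [set x | exists2 i, (N <= i)%N & x = u i]) => /=.
  by split; exists N => // i /= Ni; exists i.
move=> [_ _] /= [[i Ni ->] [j Nj ->]]; rewrite /ball /=.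
by apply: le_lt_trans (NP i j Ni Nj) _; rewrite ltr_pdivrMr // ltr_pMr // ltr1n.
Qed.

Lemma cvgc_cauchy (u : nat -> C) :
  (forall e : R, 0 < e ->
    exists N, forall i j, (N <= i)%N -> (N <= j)%N -> `|u i - u j| <= e%:C%C) ->
  cvgn u.
Proof.
move=> cu; apply: is_cvg_complex; apply: cvgr_cauchy => e /cu[N NP];
  exists N => i j Ni Nj; rewrite -raddfB -lecR.
  exact: le_trans (normc_ge_Re _) (NP i j Ni Nj).
exact: le_trans (normc_ge_Im _) (NP i j Ni Nj).
Qed.

Lemma cvgc_norm_sqr (u : nat -> C) (l : C) :
  u @ \oo --> l -> (fun n => `|u n| ^+ 2) @ \oo --> `|l| ^+ 2.
Proof. by move=> /cvg_norm ul; rewrite expr2; exact: cvgM. Qed.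

Lemma cvgc_series (u : nat -> nat -> C) (l : nat -> C) N :
  (forall k, (fun n => u n k) @ \oo --> l k) ->
  (fun n => series (u n) N) @ \oo --> series l N.
Proof.
move=> ul; elim: N => [|N IHN].
  apply: eq_cvgc (cvgc_cst _) => n; rewrite /series /= !big_geq //.
rewrite seriesSr; apply: eq_cvgc (cvgcD IHN (ul N)) => n.
by rewrite seriesSr.
Qed.

(** The partial sums are complex numbers that happen to be real: their real parts are monotone and
    bounded, their imaginary parts vanish. *)
Lemma bounded_square_summable (a : nat -> C) (B : R) :
  (forall N, series (fun n => `|a n| ^+ 2) N <= B%:C%C) -> square_summable a.
Proof.
move=> aB; apply: is_cvg_complex.
  apply: nondecreasing_is_cvgn.
    apply/nondecreasing_seqP => n; rewrite seriesSr raddfD lerDl.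
    have : 0 <= `|a n| ^+ 2 by rewrite exprn_ge0.
    by rewrite lecE => /andP[].
  by exists B => _ [n _ <-]; have := aB n; rewrite lecE => /andP[].
apply: (is_cvg_near_cst (complex.Im (0 : C))); apply: nearW => n.
have : 0 <= series (fun n => `|a n| ^+ 2) n.
  by rewrite /series sumr_ge0 // => i _; rewrite exprn_ge0.
by rewrite lecE => /andP[/eqP].
Qed.

Local Notation hardy_sqr := (dot_sqr (@hardy_dot R)).

Lemma hardy_sqr_cvg f :
  series (fun n => `|hardy_coef f n| ^+ 2) @ \oo --> ((hardy_sqr f)%:C%C : C).
Proof.
rewrite dot_sqrE; apply: eq_cvg_series (@hardy_dot_cvg R f f) => n.
by rewrite normCK.
Qed.

Lemma series_hardy_sqr_le f N :
  series (fun n => `|hardy_coef f n| ^+ 2) N <= (hardy_sqr f)%:C%C.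
Proof.
apply: cvgc_ge (@hardy_sqr_cvg f); near=> n.
have Nn : (N <= n)%N by near: n; exists N.
rewrite /series /= (big_cat_nat _ Nn) //= lerDl sumr_ge0 //.
Unshelve. all: by end_near. Qed.

Lemma coef_hardy_sqr_le f n : `|hardy_coef f n| ^+ 2 <= (hardy_sqr f)%:C%C.
Proof.
apply: le_trans (series_hardy_sqr_le f n.+1); rewrite seriesSr lerDr.
by rewrite /series sumr_ge0 // => i _; rewrite exprn_ge0.
Qed.

Lemma hardy_coefB f g n :
  hardy_coef (f - g) n = hardy_coef f n - hardy_coef g n.
Proof.
by rewrite addrC -scaleN1r hardy_coef_lin mulN1r addrC.
Qed.

(** This is completeness of square-summable sequences. Each coefficient is Cauchy, with limit [a k];
    in a partial sum of fixed length [K] the index [j] goes to infinity, and the resulting bound is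
    uniform in [K]. *)
Lemma hardy_complete (f : nat -> H2) :
  dot_cauchy (@hardy_dot R) f -> exists g, dot_cvg (@hardy_dot R) f g.
Proof.
move=> cf.
have /choice[a ca] k : exists l : C, (fun n => hardy_coef (f n) k) @ \oo --> l.
  apply/cvgc_ex/cvgc_cauchy => e e0.
  have [N NP] := cf _ (exprn_gt0 2 e0); exists N => i j Ni Nj.
  have e0' : 0 <= e%:C%C :> C by rewrite (lecR 0) ltW.
  rewrite -hardy_coefB -ler_sqr ?nnegrE //.
  apply: le_trans (coef_hardy_sqr_le _ _) _.
  by rewrite -rmorphXn lecR; exact: NP.
have bnd (e : R) N : (forall i j, (N <= i)%N -> (N <= j)%N ->
    hardy_sqr (f i - f j) <= e) -> forall i, (N <= i)%N -> forall K,
    series (fun k => `|hardy_coef (f i) k - a k| ^+ 2) K <= e%:C%C.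
  move=> NP i Ni K.
  have h k : (fun j => `|hardy_coef (f i) k - hardy_coef (f j) k| ^+ 2) @ \oo
      --> `|hardy_coef (f i) k - a k| ^+ 2.
    apply: cvgc_norm_sqr; exact: cvgcB (cvgc_cst _) (ca k).
  have {}h := @cvgc_series
    (fun j k => `|hardy_coef (f i) k - hardy_coef (f j) k| ^+ 2) _ K h.
  apply: cvgc_le h; near=> j.
  have Nj : (N <= j)%N by near: j; exists N.
  have {NP} := NP i j Ni Nj; rewrite -lecR; apply: le_trans.
  under eq_fun do rewrite -hardy_coefB.
  exact: series_hardy_sqr_le.
have [g ga] : exists g, hardy_coef g = a.
  apply: hardy_of_coef; have [N NP] := cf 1 ltr01.
  have sa := bounded_square_summable (bnd _ _ NP N (leqnn N)).
  have [sf _] := hardy_coefP (f N).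
  (* [a] is recovered as the coefficients of [f N] minus the square-summable difference
     [f N - a]. *)
  have := @square_summableP _ (-1) _ _ sa sf.
  by under eq_fun do rewrite mulN1r opprB subrK.
exists g => e /cf[N NP]; exists N => i Ni; rewrite -lecR.
apply: cvgc_le (@hardy_sqr_cvg (f i - g)); apply: nearW => K.
by under eq_fun do rewrite hardy_coefB ga; exact: bnd NP i Ni K.
Unshelve. all: by end_near. Qed.

Lemma closed_hardy_lim (M : set H2) (p : nat -> H2) g : closed M ->
  (forall n, M (p n)) ->
  dot_cvg (@hardy_dot R) p g -> M g.
Proof.
move=> cM Mp pg; apply: cM => B /nbhs_ballP[e /= e0 eB].
(* Radii of balls in a normed space over [R[i]] are complex; positivity makes [e] real. *)
have eE : e = (complex.Re e)%:C%C.
  by rewrite RRe_real // gtr0_real.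
have e0' : 0 < complex.Re e by rewrite -ltcR -eE.
(* The square matches the squared distance in [dot_cvg], the half gives strict inequality. *)
have [N NP] := pg _ (exprn_gt0 2 (divr_gt0 e0' (ltr0Sn _ 1))).
exists (p N); split=> //; apply: eB; rewrite -ball_normE /=.
rewrite distrC hardy_normE -dot_sqrE.
rewrite -ltr_sqr ?nnegrE ?sqrtC_ge0 ?(ltW e0) ?lecR ?dot_sqr_ge0 // sqrtCK.
rewrite eE -rmorphXn ltcR (le_lt_trans (NP N (leqnn N))) //.
by rewrite ltr_sqr ?nnegrE ?(ltW e0') ?divr_ge0 ?(ltW e0') //
  ltr_pdivrMr // ltr_pMr // ltr1n.
Qed.

Lemma hardy_projection (M : set H2) v : closed_subspace M ->
  exists p, M p /\ forall x, M x -> hardy_dot (v - p) x = 0.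
Proof.
move=> [sM cM]; apply: dot_projection => // p Mp /hardy_complete[g pg].
by exists g => //; exact: closed_hardy_lim pg.
Qed.

Lemma Tz_star_dot (f g : H2) : hardy_dot (Tz_star f) g = hardy_dot f (Tz g).
Proof. by rewrite hardy_dotC -Tz_starP -hardy_dotC. Qed.

(** The shift moves coefficients by one place and puts 0 first, so it preserves inner products. *)
Lemma Tz_orthonormal n (f : n.-tuple H2) :
  orthonormal (@hardy_dot R) f ->
  orthonormal (@hardy_dot R) [tuple Tz (tnth f i) | i < n].
Proof.
move=> of_; have TT x y : hardy_dot (Tz x) (Tz y) = hardy_dot x y.
  by apply: hardy_dot_Tz => k; rewrite hardy_coef_Tz.
have Tf i j : hardy_dot (Tz (tnth f i)) (Tz (tnth f j)) = (i == j)%:R.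
  by rewrite TT; exact: orthonormal_tnth.
apply/orthonormalP; split.
  (* Equal images at distinct indices would force [1 = 0]. *)
  apply/tuple_uniqP => i j; rewrite !tnth_mktuple => Tij.
  have := Tf i j; rewrite Tij Tf eqxx; case: (i =P j) => // _ /eqP.
  by rewrite oner_eq0.
move=> _ _ /tnthP[i ->] /tnthP[j ->]; rewrite !tnth_mktuple [LHS]Tf.
case: eqP => [->|ij]; first by rewrite eqxx.
case: eqP => // Tij; have := Tf i j; rewrite Tij Tf eqxx.
by move/eqP: ij => /negPf -> /esym.
Qed.

End Hardy.

Theorem theorem1p2 (R : realType) (m : nat) (hm : (1 <= m)%N)
    (M : set (hardy R)) (hM : closed_subspace M) :
  (forall u v : m.-tuple (hardy R),
     orthonormal (@hardy_dot R) u -> orthonormal (@hardy_dot R) v ->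
     invariant_under
       (@Tz_star R
        - \sum_(i < m) tensor (@hardy_dot R) (tnth v i) (tnth u i)) M ->
     almost_invariant (@hardy_dot R) (@Tz_star R) M /\
     exists d : nat,
       has_defect (@hardy_dot R) (@Tz_star R) M d /\ (d <= m)%N) /\
  (almost_invariant (@hardy_dot R) (@Tz_star R) M ->
   has_defect (@hardy_dot R) (@Tz_star R) M m ->
   forall (F : set (hardy R)) (f : m.-tuple (hardy R)),
     defect_space (@hardy_dot R) (@Tz_star R) M F ->
     orthonormal_basis (@hardy_dot R) f F ->
     exists t : nat,
       [/\ (t <= m)%N,
           has_rank t
             (\sum_(i < m)
                tensor (@hardy_dot R) (tnth f i) (Tz (tnth f i))) &
           invariant_under
             (@Tz_star R
              - \sum_(i < m)
                  tensor (@hardy_dot R) (tnth f i) (Tz (tnth f i))) M]).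
Proof.
split=> [u v _ _ inv|_ _ F f [TF _] [of_ FE]].
  have /choice[p pP] i : exists p, M p /\
      forall x, M x -> hardy_dot (tnth v i - p) x = 0.
    exact: hardy_projection.
  have TF := invariant_maps_into_oplus hM.1 (fun i => (pP i).1)
    (fun i => (pP i).2) inv.
  (* Some [v_i - p_i] may vanish or depend on the others, so only [d <= m] is available. *)
  have [d [dm dF]] := lin_span_dim [tuple tnth v i - p i | i < m].
  split; first by exists d; eexists; split; [exact: dF|exact: TF].
  have [d' [d'P d'd]] := has_defect_le dF TF.
  by exists d'; split=> //; exact: leq_trans dm.
(* Both [f] and its image under [Tz] are orthonormal, so the rank is exactly [m]. *)
exists m; split=> //.
  under eq_bigr do rewrite -[Tz _](tnth_mktuple (fun i => Tz (tnth f i))).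
  exact: has_rank_tensor of_ (Tz_orthonormal of_).
by rewrite FE in TF; exact: (maps_into_oplus_invariant (@Tz_star_dot R) of_ TF).
Qed.
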